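(* Let $(\mathcal{A},\mathcal{B},\mathcal{C})$ be a weak $\mathfrak{s}$-recollement of extriangulated categories. If $\mathcal{A}$, $\mathcal{B}$, $\mathcal{C}$ are abelian categories (with their standard extriangulated structure), then $(\mathcal{A},\mathcal{B},\mathcal{C})$ is a recollement of abelian categories.
   Context: Extriangulated categories (Nakaoka--Palu). An extriangulated category is a triple $(\mathcal{C},\mathbb{E},\mathfrak{s})$ where $\mathcal{C}$ is an additive category, $\mathbb{E}:\mathcal{C}^{\mathrm{op}}\times\mathcal{C}\to\mathrm{Ab}$ is an additive bifunctor, and $\mathfrak{s}$ is an additive realization assigning to each $\delta\in\mathbb{E}(C,A)$ an equivalence class $\mathfrak{s}(\delta)=[A\xrightarrow{x}B\xrightarrow{y}C]$, subject to the Nakaoka--Palu axioms (ET3), (ET3)$^{\mathrm{op}}$, (ET4), (ET4)$^{\mathrm{op}}$. If $\mathfrak{s}(\delta)=[A\xrightarrow{x}B\xrightarrow{y}C]$, the sequence is a conflation, $x$ is an inflation, $y$ is a deflation, $C=\mathrm{Cone}(x)$, $A=\mathrm{CoCone}(y)$, and $A\to B\to C\dashrightarrow$ is an $\mathbb{E}$-triangle. An abelian category is extriangulated with $\mathbb{E}=\mathrm{Ext}^1$, the conflations being the short exact sequences (so inflations are monomorphisms, deflations are epimorphisms). Exact functor. An additive functor $F:\mathcal{A}\to\mathcal{B}$ between extriangulated categories is exact if there is a natural transformation $\eta:\mathbb{E}_{\mathcal{A}}(-,-)\Rightarrow\mathbb{E}_{\mathcal{B}}(F(-),F(-))$ with $\mathfrak{s}_{\mathcal{B}}(\eta_{(C,A)}(\delta))=[FA\xrightarrow{Fx}FB\xrightarrow{Fy}FC]$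 whenever $\mathfrak{s}_{\mathcal{A}}(\delta)=[A\xrightarrow{x}B\xrightarrow{y}C]$. A sequence $A\xrightarrow{f}B\xrightarrow{g}C$ is right $\mathfrak{s}$-exact if there are an $\mathbb{E}$-triangle $K\xrightarrow{h_2}B\xrightarrow{g}C\dashrightarrow$ and a deflation $h_1:A\to K$ with $f=h_2h_1$; it is left $\mathfrak{s}$-exact if there are an $\mathbb{E}$-triangle $A\xrightarrow{f}B\xrightarrow{h_1}K\dashrightarrow$ and an inflation $h_2:K\to C$ with $g=h_2h_1$. Weak $\mathfrak{s}$-recollement. For extriangulated categories $\mathcal{A},\mathcal{B},\mathcal{C}$, a weak $\mathfrak{s}$-recollement $(\mathcal{A},\mathcal{B},\mathcal{C})$ consists of additive functors $i_*:\mathcal{A}\to\mathcal{B}$, $i^*,i^!:\mathcal{B}\to\mathcal{A}$, $j^*:\mathcal{B}\to\mathcal{C}$, $j_!,j_*:\mathcal{C}\to\mathcal{B}$ such that: (SR1) $(i^*,i_*,i^!)$ and $(j_!,j^*,j_* )$ are adjoint triples, and $i_*$ and $j^*$ are exact; (SR2) $j^*i_*=0$; (SR3) $i_*,j_!,j_*$ are fully faithful; (SR4) for each $X\in\mathcal{B}$ there are a left $\mathfrak{s}$-exact sequence $i_*i^!X\xrightarrow{\theta_X}X\xrightarrow{\vartheta_X}j_*j^*X$ and a right $\mathfrak{s}$-exact sequence $j_!j^*X\xrightarrow{\upsilon_X}X\xrightarrow{\nu_X}i_*i^*X$, with $\mathrm{Cone}(\theta_X)\in\mathrm{Ker}\,i^!$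 and $\mathrm{CoCone}(\nu_X)\in\mathrm{Ker}\,i^*$, all maps being the adjunction (unit/counit) morphisms. Here $\mathrm{Ker}\,F$ is the full subcategory of objects annihilated by $F$. Recollement of abelian categories: a diagram of additive functors of the same shape between abelian categories such that $(i^*,i_*,i^!)$ and $(j_!,j^*,j_* )$ are adjoint triples, $i_*,j_!,j_*$ are fully faithful, and $\mathrm{Im}\,i_*=\mathrm{Ker}\,j^*$ (essential image). *)

(* Defs.v *)
(* MathComp, with mathcomp-classical for sets of sequences. *)
From HB Require Import structures.
From mathcomp Require Import all_boot all_algebra.
From mathcomp Require Import boolp classical_sets functions.

Set Implicit Arguments.
Unset Strict Implicit.
Unset Printing Implicit Defensive.

Import GRing.Theory.
Local Open Scope classical_set_scope.
Local Open Scope ring_scope.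

(** * Additive categories and functors *)

Record preadditive := Preadditive {
  obj :> Type;
  mor : obj -> obj -> zmodType;
  idm : forall X, mor X X;
  cmp : forall X Y Z, mor Y Z -> mor X Y -> mor X Z;
  cmpA : forall W X Y Z (h : mor Y Z) (g : mor X Y) (f : mor W X),
    cmp h (cmp g f) = cmp (cmp h g) f;
  cmp1m : forall X Y (f : mor X Y), cmp (idm Y) f = f;
  cmpm1 : forall X Y (f : mor X Y), cmp f (idm X) = f;
  cmpDl : forall X Y Z (g g' : mor Y Z) (f : mor X Y),
    cmp (g + g') f = cmp g f + cmp g' f;
  cmpDr : forall X Y Z (g : mor Y Z) (f f' : mor X Y),
    cmp g (f + f') = cmp g f + cmp g f'
}.

Arguments mor {p} _ _ : rename.
Arguments idm {p} _ : rename.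
Arguments cmp {p X Y Z} _ _ : rename.

Notation "g \oc f" := (cmp g f) (at level 40, left associativity).

Definition is_iso (C : preadditive) (X Y : C) (f : mor X Y) : Prop :=
  exists g : mor Y X, g \oc f = idm X /\ f \oc g = idm Y.

Definition isomorphic (C : preadditive) (X Y : C) : Prop :=
  exists f : mor X Y, is_iso f.

Definition is_zero (C : preadditive) (Z : C) : Prop :=
  forall X : C, (forall f g : mor X Z, f = g) /\ (forall f g : mor Z X, f = g).

Record biproduct (C : preadditive) (X Y : C) := Biproduct {
  bip :> C;
  in1 : mor X bip;
  in2 : mor Y bip;
  pr1 : mor bip X;
  pr2 : mor bip Y;
  pr1_in1 : pr1 \oc in1 = idm X;
  pr2_in2 : pr2 \oc in2 = idm Y;
  pr1_in2 : pr1 \oc in2 = 0;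
  pr2_in1 : pr2 \oc in1 = 0;
  bip_id : in1 \oc pr1 + in2 \oc pr2 = idm bip
}.

Arguments in1 {C X Y} b : rename.
Arguments in2 {C X Y} b : rename.
Arguments pr1 {C X Y} b : rename.
Arguments pr2 {C X Y} b : rename.

Definition additive_category (C : preadditive) : Prop :=
  (exists Z : C, is_zero Z) /\ (forall X Y : C, inhabited (biproduct X Y)).

Record afunctor (A B : preadditive) := AFunctor {
  fobj :> A -> B;
  fmap : forall X Y : A, mor X Y -> mor (fobj X) (fobj Y);
  fmap1 : forall X : A, fmap (idm X) = idm (fobj X);
  fmap_cmp : forall (X Y Z : A) (g : mor Y Z) (f : mor X Y),
    fmap (g \oc f) = fmap g \oc fmap f;
  fmapD : forall (X Y : A) (f f' : mor X Y), fmap (f + f') = fmap f + fmap f'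
}.

Arguments fmap {A B} F {X Y} _ : rename.

(* [ker_functor F X]: X belongs to Ker F. *)
Definition ker_functor (A B : preadditive) (F : afunctor A B) (X : A) : Prop :=
  is_zero (F X).

Definition ess_image (A B : preadditive) (F : afunctor A B) (Y : B) : Prop :=
  exists X : A, isomorphic (F X) Y.

Definition fully_faithful (A B : preadditive) (F : afunctor A B) : Prop :=
  forall X Y : A, bijective (fun f : mor X Y => fmap F f).

(* [adjunction F G]: F is left adjoint to G. *)
Record adjunction (A B : preadditive) (F : afunctor A B) (G : afunctor B A) :=
Adjunction {
  adj_unit : forall X : A, mor X (G (F X));
  adj_counit : forall Y : B, mor (F (G Y)) Y;
  adj_unit_nat : forall (X X' : A) (f : mor X X'),
    fmap G (fmap F f) \oc adj_unit X = adj_unit X' \oc f;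
  adj_counit_nat : forall (Y Y' : B) (g : mor Y Y'),
    g \oc adj_counit Y = adj_counit Y' \oc fmap F (fmap G g);
  triangleL : forall X : A, adj_counit (F X) \oc fmap F (adj_unit X) = idm (F X);
  triangleR : forall Y : B, fmap G (adj_counit Y) \oc adj_unit (G Y) = idm (G Y)
}.

(** * Extriangulated categories *)

(* Additive bifunctor C^op x C -> Ab; the first argument is contravariant. *)
Record bifunctor (C : preadditive) := Bifunctor {
  bifun :> C -> C -> zmodType;
  push : forall X A A' : C, mor A A' -> bifun X A -> bifun X A';
  pull : forall X X' A : C, mor X' X -> bifun X A -> bifun X' A;
  pushD : forall (X A A' : C) (a : mor A A') (d d' : bifun X A),
    push a (d + d') = push a d + push a d';
  pullD : forall (X X' A : C) (c : mor X' X) (d d' : bifun X A),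
    pull c (d + d') = pull c d + pull c d';
  push1 : forall (X A : C) (d : bifun X A), push (idm A) d = d;
  pull1 : forall (X A : C) (d : bifun X A), pull (idm X) d = d;
  push_cmp : forall (X A A' A'' : C) (a' : mor A' A'') (a : mor A A')
    (d : bifun X A), push (a' \oc a) d = push a' (push a d);
  pull_cmp : forall (X X' X'' A : C) (c : mor X' X) (c' : mor X'' X')
    (d : bifun X A), pull (c \oc c') d = pull c' (pull c d);
  push_pull : forall (X X' A A' : C) (a : mor A A') (c : mor X' X)
    (d : bifun X A), push a (pull c d) = pull c (push a d);
  push_homD : forall (X A A' : C) (a a' : mor A A') (d : bifun X A),
    push (a + a') d = push a d + push a' d;
  pull_homD : forall (X X' A : C) (c c' : mor X' X) (d : bifun X A),
    pull (c + c') d = pull c d + pull c' d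
}.

Arguments push {C} E {X A A'} _ _ : rename.
Arguments pull {C} E {X X' A} _ _ : rename.

(* A sequence A -x-> B -y-> D with fixed ends and arbitrary middle term. *)
Record cseq (C : preadditive) (A D : C) := CSeq {
  mid : C;
  cfst : mor A mid;
  csnd : mor mid D
}.

Arguments CSeq {C A D mid} _ _ : rename.
Arguments mid {C A D} _ : rename.
Arguments cfst {C A D} _ : rename.
Arguments csnd {C A D} _ : rename.

Definition cseq_equiv (C : preadditive) (A D : C) (S T : cseq A D) : Prop :=
  exists b : mor (mid S) (mid T),
    [/\ is_iso b, b \oc cfst S = cfst T & csnd T \oc b = csnd S].

(* The equivalence class [A -x-> B -y-> D]. *)
Definition cclass (C : preadditive) (A B D : C) (x : mor A B) (y : mor B D) :
  set (cseq A D) := [set T | cseq_equiv (CSeq x y) T].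

(* Every value is required to be an equivalence class in [is_realization]. *)
Definition correspondence (C : preadditive) (E : bifunctor C) :=
  forall D A : C, E D A -> set (cseq A D).

Definition is_realization (C : preadditive) (E : bifunctor C)
    (s : correspondence E) : Prop :=
  (forall (D A : C) (d : E D A),
     exists (B : C) (x : mor A B) (y : mor B D), s D A d = cclass x y) /\
  (forall (A B D A' B' D' : C) (d : E D A) (d' : E D' A')
     (x : mor A B) (y : mor B D) (x' : mor A' B') (y' : mor B' D')
     (a : mor A A') (c : mor D D'),
     s D A d = cclass x y -> s D' A' d' = cclass x' y' ->
     push E a d = pull E c d' ->
     exists b : mor B B', b \oc x = x' \oc a /\ y' \oc b = c \oc y).

Definition dsum_mor (C : preadditive) (X Y X' Y' : C)
    (P : biproduct X X') (Q : biproduct Y Y') (f : mor X Y) (f' : mor X' Y') :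
  mor P Q := in1 Q \oc f \oc pr1 P + in2 Q \oc f' \oc pr2 P.

(* The element of E(D + D', A + A') with components (d, 0, 0, d'). *)
Definition dsum_ext (C : preadditive) (E : bifunctor C) (D A D' A' : C)
    (PD : biproduct D D') (PA : biproduct A A') (d : E D A) (d' : E D' A') :
  E PD PA :=
  push E (in1 PA) (pull E (pr1 PD) d) + push E (in2 PA) (pull E (pr2 PD) d').

Definition is_additive_realization (C : preadditive) (E : bifunctor C)
    (s : correspondence E) : Prop :=
  [/\ is_realization s,
      forall (A D : C) (P : biproduct A D),
        s D A 0 = cclass (in1 P) (pr2 P)
    & forall (A B D A' B' D' : C) (d : E D A) (d' : E D' A')
        (x : mor A B) (y : mor B D) (x' : mor A' B') (y' : mor B' D')
        (PA : biproduct A A') (PB : biproduct B B') (PD : biproduct D D'),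
        s D A d = cclass x y -> s D' A' d' = cclass x' y' ->
        s PD PA (dsum_ext PD PA d d') =
          cclass (dsum_mor PA PB x x') (dsum_mor PB PD y y')].

Definition ET3 (C : preadditive) (E : bifunctor C) (s : correspondence E) :
    Prop :=
  forall (A B D A' B' D' : C) (d : E D A) (d' : E D' A')
    (x : mor A B) (y : mor B D) (x' : mor A' B') (y' : mor B' D')
    (a : mor A A') (b : mor B B'),
    s D A d = cclass x y -> s D' A' d' = cclass x' y' ->
    b \oc x = x' \oc a ->
    exists c : mor D D', c \oc y = y' \oc b /\ push E a d = pull E c d'.

Definition ET3op (C : preadditive) (E : bifunctor C) (s : correspondence E) :
    Prop :=
  forall (A B D A' B' D' : C) (d : E D A) (d' : E D' A')
    (x : mor A B) (y : mor B D) (x' : mor A' B') (y' : mor B' D')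
    (b : mor B B') (c : mor D D'),
    s D A d = cclass x y -> s D' A' d' = cclass x' y' ->
    c \oc y = y' \oc b ->
    exists a : mor A A', b \oc x = x' \oc a /\ push E a d = pull E c d'.

(*   A -f-> B -f'-> D
     |      g       u
     A -h-> M -h'-> N
            g'      v
            F ----- F     *)
Definition ET4 (C : preadditive) (E : bifunctor C) (s : correspondence E) :
    Prop :=
  forall (A B D M F : C) (d : E D A) (d' : E F B)
    (f : mor A B) (f' : mor B D) (g : mor B M) (g' : mor M F),
    s D A d = cclass f f' -> s F B d' = cclass g g' ->
    exists (N : C) (u : mor D N) (v : mor N F) (h : mor A M) (h' : mor M N)
      (d'' : E N A),
      [/\ [/\ h = g \oc f, h' \oc g = u \oc f' & v \oc h' = g'],
          s N A d'' = cclass h h',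
          s F D (push E f' d') = cclass u v,
          pull E u d'' = d
        & push E f d'' = pull E v d'].

(*   D -u-> N -v-> F
     |      h'     g'
     D -f'-> A -f-> B
             h      g
             M ---- M     *)
Definition ET4op (C : preadditive) (E : bifunctor C) (s : correspondence E) :
    Prop :=
  forall (A B D M F : C) (d : E B D) (d' : E M F)
    (f' : mor D A) (f : mor A B) (g' : mor F B) (g : mor B M),
    s B D d = cclass f' f -> s M F d' = cclass g' g ->
    exists (N : C) (u : mor D N) (v : mor N F) (h' : mor N A) (h : mor A M)
      (d'' : E M N),
      [/\ [/\ h = g \oc f, f \oc h' = g' \oc v & h' \oc u = f'],
          s M N d'' = cclass h' h,
          s F D (pull E g' d) = cclass u v,
          push E v d'' = d'
        & push E u d = pull E g d''].

Record extriangulated := Extriangulated {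
  ecat :> preadditive;
  ecat_additive : additive_category ecat;
  ext : bifunctor ecat;
  realize : correspondence ext;
  realize_additive : is_additive_realization realize;
  realize_ET3 : ET3 realize;
  realize_ET3op : ET3op realize;
  realize_ET4 : ET4 realize;
  realize_ET4op : ET4op realize
}.

Arguments realize {e D A} _ : rename.

Definition conflation (C : extriangulated) (A B D : C)
    (x : mor A B) (y : mor B D) : Prop :=
  exists d : ext C D A, realize d = cclass x y.

Definition is_cone (C : extriangulated) (A B : C) (x : mor A B) (D : C) :
  Prop := exists y : mor B D, conflation x y.

Definition is_cocone (C : extriangulated) (B D : C) (y : mor B D) (A : C) :
  Prop := exists x : mor A B, conflation x y.

Definition inflation (C : extriangulated) (A B : C) (x : mor A B) : Prop :=
  exists D : C, is_cone x D.

Definition deflation (C : extriangulated) (B D : C) (y : mor B D) : Prop :=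
  exists A : C, is_cocone y A.

Definition right_s_exact (C : extriangulated) (A B D : C)
    (f : mor A B) (g : mor B D) : Prop :=
  exists (K : C) (h2 : mor K B) (h1 : mor A K),
    [/\ conflation h2 g, deflation h1 & f = h2 \oc h1].

Definition left_s_exact (C : extriangulated) (A B D : C)
    (f : mor A B) (g : mor B D) : Prop :=
  exists (K : C) (h1 : mor B K) (h2 : mor K D),
    [/\ conflation f h1, inflation h2 & g = h2 \oc h1].

(* Each component of the natural transformation is a morphism of abelian
   groups. *)
Definition exact_functor (A B : extriangulated) (F : afunctor A B) : Prop :=
  exists eta : forall X Y : A, ext A X Y -> ext B (F X) (F Y),
    [/\ forall (X Y : A) (d d' : ext A X Y),
          eta X Y (d + d') = eta X Y d + eta X Y d',
        forall (X Y Y' : A) (a : mor Y Y') (d : ext A X Y),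
          eta X Y' (push (ext A) a d) = push (ext B) (fmap F a) (eta X Y d),
        forall (X X' Y : A) (c : mor X' X) (d : ext A X Y),
          eta X' Y (pull (ext A) c d) = pull (ext B) (fmap F c) (eta X Y d)
      & forall (X Y Z : A) (d : ext A Z X) (x : mor X Y) (y : mor Y Z),
          realize d = cclass x y ->
          realize (eta Z X d) = cclass (fmap F x) (fmap F y)].

(** * Abelian categories and their standard extriangulated structure *)

Definition is_mono (C : preadditive) (X Y : C) (f : mor X Y) : Prop :=
  forall (W : C) (g h : mor W X), f \oc g = f \oc h -> g = h.

Definition is_epi (C : preadditive) (X Y : C) (f : mor X Y) : Prop :=
  forall (Z : C) (g h : mor Y Z), g \oc f = h \oc f -> g = h.

(* [is_kernel k f]: k is a kernel of f. *)
Definition is_kernel (C : preadditive) (K X Y : C)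
    (k : mor K X) (f : mor X Y) : Prop :=
  f \oc k = 0 /\
  forall (W : C) (g : mor W X), f \oc g = 0 -> exists! u : mor W K, k \oc u = g.

(* [is_cokernel q f]: q is a cokernel of f. *)
Definition is_cokernel (C : preadditive) (X Y Q : C)
    (q : mor Y Q) (f : mor X Y) : Prop :=
  q \oc f = 0 /\
  forall (Z : C) (g : mor Y Z), g \oc f = 0 -> exists! u : mor Q Z, u \oc q = g.

Definition abelian (C : preadditive) : Prop :=
  [/\ additive_category C,
      forall (X Y : C) (f : mor X Y), exists (K : C) (k : mor K X), is_kernel k f,
      forall (X Y : C) (f : mor X Y), exists (Q : C) (q : mor Y Q), is_cokernel q f,
      forall (X Y : C) (f : mor X Y), is_mono f ->
        exists (Z : C) (g : mor Y Z), is_kernel f g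
    & forall (X Y : C) (f : mor X Y), is_epi f ->
        exists (W : C) (g : mor W X), is_cokernel f g].

Definition short_exact (C : preadditive) (A B D : C)
    (x : mor A B) (y : mor B D) : Prop :=
  is_kernel x y /\ is_cokernel y x.

(* Yoneda Ext^1(D, A): the equivalence classes of short exact sequences
   A -> B -> D. *)
Definition Ext1 (C : preadditive) (D A : C) : set (set (cseq A D)) :=
  [set c | exists (B : C) (x : mor A B) (y : mor B D),
     short_exact x y /\ c = cclass x y].

Arguments Ext1 {C} D A _.

(* The realization identifies E(D, A) with Yoneda Ext^1(D, A). Nothing further
   is needed to identify E with Ext^1 as additive bifunctors: that a_*, c^* and
   + correspond to pushout, pullback and Baer sum of short exact sequences is
   forced by s being an additive realization, since the diagrams it provides
   over (a, 1) and (1, c) are pushout and pullback diagrams, and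
   d + d' is the image of (d, 0, 0, d') under the codiagonal and diagonal. *)
Definition standard_abelian (C : extriangulated) : Prop :=
  abelian C /\
  forall D A : C, set_bij [set: ext C D A] (Ext1 D A) (fun d => realize d).

(** * Recollements *)

Record recollement_diagram (A B C : preadditive) := RecollementDiagram {
  i_star : afunctor A B;     (* i_* *)
  i_upstar : afunctor B A;   (* i^* *)
  i_upshriek : afunctor B A; (* i^! *)
  j_upstar : afunctor B C;   (* j^* *)
  j_shriek : afunctor C B;   (* j_! *)
  j_star : afunctor C B      (* j_* *)
}.

(* The adjunctions are data because the exact sequences below use
   their units and counits. *)
Record weak_s_recollement (A B C : extriangulated)
    (R : recollement_diagram A B C) := WeakSRecollement {
  i_adjL : adjunction (i_upstar R) (i_star R);
  i_adjR : adjunction (i_star R) (i_upshriek R);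
  j_adjL : adjunction (j_shriek R) (j_upstar R);
  j_adjR : adjunction (j_upstar R) (j_star R);
  i_star_exact : exact_functor (i_star R);
  j_upstar_exact : exact_functor (j_upstar R);
  j_upstar_i_star : forall X : A, is_zero (j_upstar R (i_star R X));
  i_star_ff : fully_faithful (i_star R);
  j_shriek_ff : fully_faithful (j_shriek R);
  j_star_ff : fully_faithful (j_star R);
  srec_left : forall X : B,
    left_s_exact (adj_counit i_adjR X) (adj_unit j_adjR X) /\
    exists2 K : B, is_cone (adj_counit i_adjR X) K & ker_functor (i_upshriek R) K;
  srec_right : forall X : B,
    right_s_exact (adj_counit j_adjL X) (adj_unit i_adjL X) /\
    exists2 K : B, is_cocone (adj_unit i_adjL X) K & ker_functor (i_upstar R) K
}.

Record abelian_recollement (A B C : preadditive)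
    (R : recollement_diagram A B C) : Prop := AbelianRecollement {
  arec_abelian : [/\ abelian A, abelian B & abelian C];
  arec_i : inhabited (adjunction (i_upstar R) (i_star R)) /\
           inhabited (adjunction (i_star R) (i_upshriek R));
  arec_j : inhabited (adjunction (j_shriek R) (j_upstar R)) /\
           inhabited (adjunction (j_upstar R) (j_star R));
  arec_i_star_ff : fully_faithful (i_star R);
  arec_j_shriek_ff : fully_faithful (j_shriek R);
  arec_j_star_ff : fully_faithful (j_star R);
  arec_im_ker : forall X : B, ess_image (i_star R) X <-> ker_functor (j_upstar R) X
}.

(* Main.v *)
Require Import Defs.
From mathcomp Require Import all_boot all_algebra.
From mathcomp Require Import classical_sets functions.

Set Implicit Arguments.
Unset Strict Implicit.
Unset Printing Implicit Defensive.

Import GRing.Theory.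
Local Open Scope classical_set_scope.
Local Open Scope ring_scope.

(** Everything an abelian recollement asks for is already part of a weak
    s-recollement, except the equality of the essential image of [i_*] with the
    kernel of [j^*].  The inclusion of the image in the kernel is [j^* i_* = 0].
    Conversely, let [j^* X = 0].  Then [j_* j^* X = 0], so the left s-exact
    sequence [i_* i^! X -> X -> j_* j^* X] factors its second map through an
    inflation [K -> 0].  In an abelian category inflations are monomorphisms,
    hence [K = 0]; and the counit [i_* i^! X -> X], being a kernel of [X -> K],
    is an isomorphism.  So [X] lies in the image of [i_*].

    The input from the standard extriangulated structure is
    [conflation_kernel]: in a conflation the first map is a kernel of the
    second. *)

Lemma cmp0m (C : preadditive) (X Y Z : C) (f : mor X Y) :
  (0 : mor Y Z) \oc f = 0.
Proof. by apply: (addrI (0 \oc f)); rewrite -cmpDl !addr0. Qed.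

Lemma cmpm0 (C : preadditive) (X Y Z : C) (g : mor Y Z) :
  g \oc (0 : mor X Y) = 0.
Proof. by apply: (addrI (g \oc 0)); rewrite -cmpDr !addr0. Qed.

Lemma fmap0 (A B : preadditive) (F : afunctor A B) (X Y : A) :
  fmap F (0 : mor X Y) = 0.
Proof. by apply: (addrI (fmap F 0)); rewrite -fmapD !addr0. Qed.

(** This makes being zero an equation between morphisms, which functors preserve
    and monomorphisms reflect. *)
Lemma is_zeroP (C : preadditive) (Z : C) : is_zero Z <-> idm Z = 0.
Proof.
split=> [Z0|id0 X]; first exact: (Z0 Z).1.
split=> f g.
  by rewrite -(cmp1m f) -(cmp1m g) id0 !cmp0m.
by rewrite -(cmpm1 f) -(cmpm1 g) id0 !cmpm0.
Qed.

Lemma is_zero_fobj (A B : preadditive) (F : afunctor A B) (X : A) :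
  is_zero X -> is_zero (F X).
Proof. by move/is_zeroP=> X0; apply/is_zeroP; rewrite -fmap1 X0 fmap0. Qed.

Lemma is_zero_mono (C : preadditive) (X Y : C) (f : mor X Y) :
  is_mono f -> is_zero Y -> is_zero X.
Proof. by move=> fm Y0; apply/is_zeroP/fm; apply: (Y0 X).1. Qed.

Lemma is_iso_mono (C : preadditive) (X Y : C) (f : mor X Y) :
  is_iso f -> is_mono f.
Proof.
by case=> g [gf _] W h k e; rewrite -(cmp1m h) -(cmp1m k) -gf -!cmpA e.
Qed.

Lemma is_iso_fmap (A B : preadditive) (F : afunctor A B) (X Y : A)
    (f : mor X Y) : is_iso f -> is_iso (fmap F f).
Proof.
by case=> g [gf fg]; exists (fmap F g); rewrite -!fmap_cmp gf fg !fmap1.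
Qed.

Lemma isomorphic_sym (C : preadditive) (X Y : C) :
  isomorphic X Y -> isomorphic Y X.
Proof. by case=> f [g [gf fg]]; exists g, f. Qed.

Lemma is_kernel_mono (C : preadditive) (K X Y : C) (k : mor K X)
    (f : mor X Y) : is_kernel k f -> is_mono k.
Proof.
move=> [fk0 ker] W g h e.
have [|u [_ uniq]] := ker W (k \oc g); first by rewrite cmpA fk0 cmp0m.
by rewrite -(uniq g erefl) -(uniq h (esym e)).
Qed.

(** The identity of [X] factors through the kernel, which makes the
    monomorphism [k] split epi. *)
Lemma is_kernel_zero_iso (C : preadditive) (K X Y : C) (k : mor K X)
    (f : mor X Y) : is_zero Y -> is_kernel k f -> is_iso k.
Proof.
move=> Y0 kerf; have km := is_kernel_mono kerf; case: kerf => _ ker.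
have [|u [ku _]] := ker X (idm X); first exact: (Y0 X).1.
exists u; split=> //.
by apply: km; rewrite cmpA ku cmp1m cmpm1.
Qed.

Lemma cseq_equiv_kernel (C : preadditive) (A D : C) (S T : cseq A D) :
  cseq_equiv S T -> is_kernel (cfst T) (csnd T) -> is_kernel (cfst S) (csnd S).
Proof.
move=> [b [bi bx yb]] [yx0 ker]; split; first by rewrite -yb -cmpA bx.
move=> W g; rewrite -yb -cmpA => /ker [u [xu uniq]]; exists u; split.
  by apply: (is_iso_mono bi); rewrite cmpA bx.
by move=> v xv; apply: uniq; rewrite -bx -cmpA xv.
Qed.

(** A conflation realizes some extension, whose class is also that of a short
    exact sequence; two representatives of one class differ by an isomorphism
    of the middle terms, along which kernels transport. *)
Lemma conflation_kernel (C : extriangulated) (hC : standard_abelian C)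
    (A B D : C) (x : mor A B) (y : mor B D) :
  conflation x y -> is_kernel x y.
Proof.
move=> [d dxy]; have [/(_ d I) + _ _] := hC.2 D A.
move=> [B' [x' [y' [[ker' _] dxy']]]].
apply: (@cseq_equiv_kernel _ _ _ (CSeq x y) (CSeq x' y')) => //.
suff : cclass x y (CSeq x' y') by [].
rewrite -dxy dxy' /cclass /=; exists (idm B'); split=> /=.
- by exists (idm B'); rewrite cmp1m.
- exact: cmp1m.
- exact: cmpm1.
Qed.

Theorem proposition4p4 (A B C : extriangulated) (R : recollement_diagram A B C)
    (hR : weak_s_recollement R)
    (hA : standard_abelian A) (hB : standard_abelian B)
    (hC : standard_abelian C) :
  abelian_recollement R.
Proof.
split.
- by split; [case: hA | case: hB | case: hC].
- by split; constructor; [exact: i_adjL hR | exact: i_adjR hR].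
- by split; constructor; [exact: j_adjL hR | exact: j_adjR hR].
- exact: i_star_ff hR.
- exact: j_shriek_ff hR.
- exact: j_star_ff hR.
move=> X; split=> [[Y /isomorphic_sym [f fi]] | X0].
  apply: is_zero_mono (is_iso_mono (is_iso_fmap (j_upstar R) fi)) _.
  exact: j_upstar_i_star hR Y.
exists (i_upshriek R X), (adj_counit (i_adjR hR) X).
have [[K [h1 [h2 [confl [N [h3 infl]] _]]]] _] := srec_left hR X.
have K0 : is_zero K.
  apply: is_zero_mono (is_kernel_mono (conflation_kernel hB infl)) _.
  exact: is_zero_fobj.
exact: is_kernel_zero_iso K0 (conflation_kernel hB confl).
Qed.
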